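(* Let $0\leq\epsilon_1\leq 1$ and $0\leq\epsilon_2\leq 2$ be real numbers. Then the capacity $C(\epsilon_1,\epsilon_2)$ of two-neighbor $k$-constrained codes with minimum inversion distance $d$, where $k=\lceil n^{\epsilon_1}\rceil$ and $d=\lceil n^{\epsilon_2}\rceil$, is $$C(\epsilon_1,\epsilon_2)=\begin{cases}\frac12+\frac{\epsilon_1}{2}, & 0\leq\epsilon_2\leq 1,\\ \frac32+\frac{\epsilon_1}{2}-\epsilon_2, & 1<\epsilon_2\leq 1+\epsilon_1,\\ 1-\frac{\epsilon_2}{2}, & 1+\epsilon_1<\epsilon_2\leq 2.\end{cases}$$
   Context: $S_n$ is the set of all permutations of $\{1,\ldots,n\}$, written $\sigma=[\sigma(1),\ldots,\sigma(n)]$. For positive integers $n,k$, a permutation $\sigma\in S_n$ satisfies the two-neighbor $k$-constraint if for all $i$ with $2\leq i\leq n-1$, either $|\sigma(i-1)-\sigma(i)|\leq k$ or $|\sigma(i)-\sigma(i+1)|\leq k$ (inclusive or). $A_{n,k}$ is the set of all permutations in $S_n$ satisfying this constraint. An adjacent transposition on $\sigma$ exchanges the entries $\sigma(i),\sigma(i+1)$ in two adjacent positions. The Kendall's $\tau$ distance $d_K(\sigma,\pi)$ is the minimum number of adjacent transpositions required to obtain $\pi$ from $\sigma$. The inversion distance is $d_I(\sigma,\pi)=d_K(\sigma^{-1},\pi^{-1})$. A code (set of permutations) has minimum inversion distance $d$ if any two distinct elements are at inversion distance at least $d$ (a one-element set qualifies). $E(n,k,d)$ is the maximum size of a code contained in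 $A_{n,k}$ with minimum inversion distance $d$. For $0\leq\epsilon_1\leq1$, $0\leq\epsilon_2\leq2$, $k=\lceil n^{\epsilon_1}\rceil$, $d=\lceil n^{\epsilon_2}\rceil$, define $C(\epsilon_1,\epsilon_2)=\lim_{n\to\infty}\frac{\log E(n,k,d)}{\log n!}$, with logarithms to base 2 (the claim includes that this limit exists). *)

(* Defs.v *)
From HB Require Import structures.
From mathcomp Require Import all_boot all_order all_algebra all_fingroup.
From mathcomp Require Import all_classical all_reals all_analysis.
Set Implicit Arguments.
Unset Strict Implicit.
Unset Printing Implicit Defensive.
Import Order.TTheory GRing.Theory Num.Theory.
Import numFieldNormedType.Exports.

(* Permutations of {1, ..., n} are represented on 'I_n = {0, ..., n-1}: both
   positions and entries are shifted by one, which changes no difference. *)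

(* (tperm i j * s) x = s (tperm i j x), so this exchanges the entries of s in
   the adjacent positions i and j = i + 1 (not the adjacent values). *)
Definition adjacent_swap (n : nat) : rel 'S_n := fun s t =>
  [exists i : 'I_n, exists j : 'I_n,
     (j == i.+1 :> nat) && (t == (tperm i j * s)%g)].

Definition swaps_in (n : nat) (s t : 'S_n) (m : nat) : bool :=
  [exists w : m.-tuple 'S_n, path (@adjacent_swap n) s w && (last s w == t)].

Lemma swaps_in_exists (n : nat) (s t : 'S_n) : exists m, swaps_in s t m.
Proof.
suff /connectP[w pw ->] : connect (@adjacent_swap n) s t.
  exists (size w); apply/existsP; exists (in_tuple w).
  by rewrite pw eqxx.
have tpermC_connect (d : nat) : forall (i j : 'I_n) (u : 'S_n),
    j = (i + d.+1)%N :> nat ->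
    connect (@adjacent_swap n) u (tperm i j * u)%g.
  elim: d => [|d IHd] i j u ji.
    apply: connect1; apply/existsP; exists i; apply/existsP; exists j.
    by rewrite ji addn1 !eqxx.
  have lt_l : (i + d.+1 < n)%N.
    by apply: leq_ltn_trans (ltn_ord j); rewrite ji leq_add2l.
  pose l := Ordinal lt_l.
  have step (v : 'S_n) : connect (@adjacent_swap n) v (tperm l j * v)%g.
    apply: connect1; apply/existsP; exists l; apply/existsP; exists j.
    by rewrite ji /= addnS !eqxx.
  have -> : tperm i j = (tperm l j * (tperm i l * tperm l j))%g.
    have <- : (tperm i l ^ tperm l j)%g = tperm i j.
      rewrite tpermJ tpermL tpermD //; apply/eqP => /(congr1 val) /= /eqP.
        by rewrite -[X in _ == X]addn0 eqn_add2l.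
      by rewrite ji -[X in _ == X]addn0 eqn_add2l.
    by rewrite conjgE tpermV.
  rewrite -!mulgA.
  apply: connect_trans (step u) _.
  by apply: connect_trans (step _); exact: IHd.
have swap_connect (i j : 'I_n) (u : 'S_n) :
    connect (@adjacent_swap n) u (tperm i j * u)%g.
  have [ij|ji|/val_inj ->] := ltngtP i j; last by rewrite tperm1 mul1g.
    by apply: (tpermC_connect (j - i.+1)%N); rewrite addnS -addSn subnKC.
  rewrite tpermC.
  by apply: (tpermC_connect (i - j.+1)%N); rewrite addnS -addSn subnKC.
rewrite -[t](mulgKV s); have [ts -> _] := prod_tpermP (t * s^-1)%g.
elim: ts => [|p ts IHts]; first by rewrite big_nil mul1g.
by rewrite big_cons -mulgA; apply: connect_trans IHts _.
Qed.

Definition kendall_tau (n : nat) (s t : 'S_n) : nat :=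
  ex_minn (swaps_in_exists s t).

Definition inversion_dist (n : nat) (s t : 'S_n) : nat :=
  kendall_tau s^-1%g t^-1%g.

Definition two_neighbor (n k : nat) (s : 'S_n) : bool :=
  [forall h : 'I_n, forall i : 'I_n, forall j : 'I_n,
     (i == h.+1 :> nat) && (j == i.+1 :> nat) ==>
       (`|s h - s i|%N <= k)%N || (`|s i - s j|%N <= k)%N].

Definition constrained_perms (n k : nat) : {set 'S_n} :=
  [set s : 'S_n | two_neighbor k s]%SET.

Definition min_inversion_dist (n d : nat) (C : {set 'S_n}) : bool :=
  [forall s in C, forall t in C, (s != t) ==> (d <= inversion_dist s t)%N].

Definition max_code_size (n k d : nat) : nat :=
  \max_(C : {set 'S_n} |
          (C \subset constrained_perms n k) && min_inversion_dist d C) #|C|.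

Local Open Scope ring_scope.

Definition log2 (R : realType) (x : R) : R := ln x / ln 2.

(* The ceiling of n ^ e, as a natural number. *)
Definition ceil_pow (R : realType) (n : nat) (e : R) : nat :=
  `|Num.ceil (n%:R `^ e)|%N.

Definition code_rate (R : realType) (e1 e2 : R) (n : nat) : R :=
  log2 (max_code_size n (ceil_pow n e1) (ceil_pow n e2))%:R / log2 n`!%:R.

(* [lim] is meaningful only when the sequence of rates converges. *)
Definition capacity (R : realType) (e1 e2 : R) : R :=
  lim (code_rate e1 e2 @ \oo)%classic.

(* Main.v *)
(* The bounds below determine ln E(n, k, d) up to O(n), which is negligible
   against ln n! ~ n ln n.  The inversion distance of s and t is at
   least half the l1 distance sum_x |s x - t x|.

   Upper bound: cut the values into blocks of length L ~ d / 2n.  Permutations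
   with the same quantization are at distance < d, so a code is no larger than
   the set of quantized constrained permutations.  There, about half of the
   entries are free (n / L choices), and each of the others is within k of its
   predecessor (O(k / L + 1) choices).

   Lower bound: an l1 ball of radius 2d contains at most 2^n C(n + 2d, n)
   permutations, and the Gilbert-Varshamov argument is applied to permutations
   of n/2 pairs of consecutive positions, each holding an even value 2a and an
   odd value 2b + 1.  Letting |a - b| range up to ~ k / 2 gives the rate for
   e2 <= 1 + e1; for larger e2 it is better to keep a = b, because then the ball
   lives in S_{n/2}. *)
Require Import Defs.
From mathcomp Require Import all_boot all_order all_algebra all_fingroup.
From mathcomp Require Import all_classical all_reals all_analysis.
From mathcomp Require Import zify ring lra.
Set Implicit Arguments.
Unset Strict Implicit.
Unset Printing Implicit Defensive.
Import Order.TTheory GRing.Theory Num.Theory.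
Import numFieldNormedType.Exports.

(** * Inversion distance and the l1 distance *)

Lemma kendall_tau_le n (s t : 'S_n) m : swaps_in s t m -> kendall_tau s t <= m.
Proof. by rewrite /kendall_tau; case: ex_minnP => p _ minp /minp. Qed.

Lemma swaps_in_kendall n (s t : 'S_n) : swaps_in s t (kendall_tau s t).
Proof. by rewrite /kendall_tau; case: ex_minnP. Qed.

Lemma kendall_tau_refl n (s : 'S_n) : kendall_tau s s = 0.
Proof.
apply/eqP; rewrite -leqn0; apply: kendall_tau_le.
by apply/existsP; exists [tuple]; rewrite /= eqxx.
Qed.

Lemma kendall_tau_triangle n (u s t : 'S_n) :
  kendall_tau s t <= kendall_tau s u + kendall_tau u t.
Proof.
apply: kendall_tau_le.
have /existsP[w /andP[pw /eqP lw]] := swaps_in_kendall s u.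
have /existsP[v /andP[pv /eqP lv]] := swaps_in_kendall u t.
apply/existsP; exists [tuple of w ++ v].
by rewrite cat_path last_cat pw lw pv lv eqxx.
Qed.

(** [tperm i j] is [tperm i l] conjugated by the adjacent [tperm l j], so widening the gap by one
    costs two more swaps. *)
Lemma kendall_tau_tperm n (d : nat) : forall (i j : 'I_n) (s : 'S_n),
  j = i + d.+1 :> nat -> kendall_tau s (tperm i j * s)%g <= (d.*2).+1.
Proof.
have adj (i j : 'I_n) (s : 'S_n) : j = i.+1 :> nat ->
    kendall_tau s (tperm i j * s)%g <= 1.
  move=> ji; apply: kendall_tau_le; apply/existsP.
  exists [tuple (tperm i j * s)%g]; rewrite /= eqxx !andbT.
  by apply/existsP; exists i; apply/existsP; exists j; rewrite ji !eqxx.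
elim: d => [|d IHd] i j s ji; first by apply: adj; rewrite ji addn1.
have lt_l : i + d.+1 < n by apply: leq_ltn_trans (ltn_ord j); rewrite ji; lia.
pose l := Ordinal lt_l.
have jl : j = l.+1 :> nat by rewrite ji /= addnS.
have -> : tperm i j = (tperm l j * (tperm i l * tperm l j))%g.
  have <- : (tperm i l ^ tperm l j)%g = tperm i j.
    by rewrite tpermJ tpermL tpermD //; apply/eqP => /(congr1 val) /=; lia.
  by rewrite conjgE tpermV.
rewrite -!mulgA.
have h1 := adj l j s jl.
have h2 := IHd i l (tperm l j * s)%g erefl.
have h3 := adj l j (tperm i l * (tperm l j * s))%g jl.
apply: leq_trans (kendall_tau_triangle (tperm l j * s)%g _ _) _.
apply: leq_trans (leq_add h1 (leq_trans (kendall_tau_triangle _ _ _)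
                                        (leq_add h2 h3))) _.
by lia.
Qed.

(** Exchanging two values of [s] exchanges two positions of its inverse. *)
Lemma inversion_dist_tperm n (i j : 'I_n) (s : 'S_n) (m : nat) :
  `|i - j| <= m -> inversion_dist s (s * tperm i j)%g <= 2 * m.
Proof.
move=> ijm; rewrite /inversion_dist invMg tpermV.
have [ij|ji|/val_inj ->] := ltngtP i j; last first.
- by rewrite tperm1 mul1g kendall_tau_refl.
- rewrite tpermC; apply: leq_trans (@kendall_tau_tperm _ (i - j).-1 j i _ _) _.
    by lia.
  by rewrite -mul2n; lia.
- apply: leq_trans (@kendall_tau_tperm _ (j - i).-1 i j _ _) _; first by lia.
  by rewrite -mul2n; lia.
Qed.

(* Repairing one disagreement at a time costs one transposition of two values
   in the same block of length [m.+1]. *)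
Lemma inversion_dist_block n m (s t : 'S_n) :
  (forall x, s x %/ m.+1 = t x %/ m.+1) ->
  inversion_dist s t <= 2 * m * n.
Proof.
suff H p : forall s : 'S_n, #|[set x | s x != t x]%SET| <= p ->
    (forall x, s x %/ m.+1 = t x %/ m.+1) -> inversion_dist s t <= 2 * m * p.
  by apply: H; rewrite -[X in _ <= X](card_ord n) max_card.
elim: p => [|p IHp] {}s.
  rewrite leqn0 cards_eq0 => /eqP s0 _.
  suff -> : s = t by rewrite /inversion_dist kendall_tau_refl.
  apply/permP => x; apply/eqP/negbNE/negP => sx.
  by have := finset.in_set0 x; rewrite -s0 inE sx.
move=> cs bl; have [s0|] := set_0Vmem [set x | s x != t x]%SET.
  by apply: leq_trans (IHp _ _ bl) _; [rewrite s0 cards0 | lia].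
case=> x; rewrite inE => sx.
have dxm : `|s x - t x| <= m by have := bl x; lia.
pose s' := (s * tperm (s x) (t x))%g.
have s'x : s' x = t x by rewrite permM tpermL.
have s'y y : s y = t y -> s' y = t y.
  move=> sy; rewrite permM tpermD //.
    by apply: contraNneq sx => /perm_inj ->; rewrite sy.
  by rewrite sy; apply: contraNneq sx => /perm_inj ->; rewrite sy.
have h1 : inversion_dist s' t <= 2 * m * p.
  apply: IHp => [|y].
    rewrite -ltnS; apply: leq_trans cs; apply: proper_card.
    apply/properP; split; last by exists x; rewrite !inE ?s'x ?eqxx.
    apply/fintype.subsetP => y; rewrite !inE.
    by apply: contraNN => /eqP /s'y ->.
  rewrite permM; case: tpermP => [/perm_inj -> //|sy|_ _]; last exact: bl.
  by rewrite bl -sy bl.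
apply: leq_trans (kendall_tau_triangle s'^-1%g _ _) _.
by apply: leq_trans (leq_add (inversion_dist_tperm s dxm) h1) _; lia.
Qed.

(** Spearman's footrule. *)
Definition footrule n (s t : 'S_n) : nat := \sum_(x < n) `|s x - t x|.

Lemma footrule_triangle n (u s t : 'S_n) :
  footrule s t <= footrule s u + footrule u t.
Proof. by rewrite /footrule -big_split; apply: leq_sum => x _ /=; lia. Qed.

Lemma footruleC n (s t : 'S_n) : footrule s t = footrule t s.
Proof. by apply: eq_bigr => x _; rewrite distnC. Qed.

(** An adjacent swap in an inverse exchanges two values that differ by one, which moves two entries
    by one each. *)
Lemma footrule_inversion_dist n (s t : 'S_n) :
  footrule s t <= 2 * inversion_dist s t.
Proof.
rewrite /inversion_dist -[in footrule _ _](invgK s) -[in footrule _ _](invgK t).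
move: s^-1%g t^-1%g => {}s {}t.
move: (kendall_tau s t) (swaps_in_kendall s t) => m.
move=> /existsP[w /andP[pw /eqP <-]]; rewrite -[X in _ <= 2 * X](size_tuple w).
elim: (tval w) s pw => {t w} [|u w IHw] s /=.
  by move=> _; rewrite /footrule big1 // => x _; rewrite distnn.
case/andP=> /existsP[i /existsP[j /andP[/eqP ji /eqP def_u]]] pw.
have sw := IHw u pw.
suff le2 : footrule s^-1%g u^-1%g <= 2.
  apply: leq_trans (footrule_triangle u^-1%g _ _) _.
  by rewrite mulnS; exact: leq_add.
rewrite def_u invMg tpermV /footrule.
rewrite (reindex_inj (@perm_inj _ s)) /=.
under eq_bigr => x _ do rewrite permM permK.
have ij : i != j by apply/eqP => eij; move: ji; rewrite eij; lia.
rewrite (bigD1 i) //= (bigD1 j) /=; last by rewrite eq_sym.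
rewrite tpermL tpermR big1 ?addn0; last first.
  by move=> x /andP[xi xj]; rewrite tpermD 1?eq_sym // distnn.
by rewrite ji; lia.
Qed.

(** * Gilbert-Varshamov bound *)

Lemma card_footrule_ball n D (s : 'S_n) :
  #|[set t : 'S_n | footrule s t <= D]%SET| <= 2 ^ n * 'C(n + D, n).
Proof.
have le_x (t : 'S_n) x : footrule s t <= D -> `|s x - t x| <= D.
  by rewrite /footrule (bigD1 x) //=; apply: leq_trans; rewrite leq_addr.
(* [t] is recovered from the signs and the absolute values of [t - s]. *)
pose g (t : 'S_n) := ([set x | s x < t x]%SET,
  [tuple (inord `|s x - t x| : 'I_D.+1) | x < n]).
rewrite -(@card_in_imset _ _ g) => [|t u]; last first.
  rewrite !inE => tD uD gE.
  have /finset.setP/= st := congr1 fst gE; have /= eg := congr1 snd gE.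
  apply/permP => x; apply/ord_inj.
  have := congr1 (fun w => nat_of_ord (tnth w x)) eg.
  rewrite !tnth_mktuple !inordK ?ltnS ?le_x // => dx.
  by move: dx (st x); rewrite !inE; lia.
(* There are [2 ^ n] sign sets, and ['C(n + D, n)] tuples of [n] naturals with sum at most [D]. *)
rewrite -(card_partial_ord_partitions n D) -[in 2 ^ n](card_ord n).
rewrite -cardsT -card_powerset -cardsX; apply: subset_leq_card.
apply/fintype.subsetP => _ /imsetP[t +->]; rewrite !inE finset.subsetT /=.
move=> tD; rewrite big_map big_enum; apply: leq_trans (tD); apply: leq_sum => x _.
by rewrite inordK ?ltnS ?le_x.
Qed.

(** Balls are counted inside the family [f] only, so a sparser family may have a smaller [M]. The
    radius is [2 * d] because the footrule is at most twice the inversion distance. *)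
Lemma packing_bound n k d (T : finType) (f : T -> 'S_n) M :
    injective f -> (forall t, f t \in constrained_perms n k) ->
    (forall t, #|[set u | footrule (f t) (f u) <= 2 * d]%SET| <= M) ->
  #|T| <= max_code_size n k d * M.
Proof.
move=> injf fA ballM.
(* The balls around a code [f @: D] of maximal size cover [T]. *)
pose P (D : {set T}) := min_inversion_dist d (f @: D).
have P0 : P finset.set0.
  by apply/forallP => s; rewrite imset0 inE.
case: (arg_maxnP (fun D : {set T} => #|D|) P0) => D PD maxD.
apply: (@leq_trans (#|D| * M)); last first.
  rewrite leq_mul2r; apply/orP; right.
  rewrite -(card_imset _ injf) /max_code_size.
  apply: (@leq_bigmax_cond _ _ (fun C : {set 'S_n} => #|C|) (f @: D)%SET).
  apply/andP; split=> //.
  by apply/fintype.subsetP => _ /imsetP[t _ ->].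
pose B t := [set u | footrule (f t) (f u) <= 2 * d]%SET.
apply: (@leq_trans #|(\bigcup_(t in D) B t)%SET|); last first.
  rewrite -sum_nat_const.
  apply: (big_ind2 (fun (A : {set T}) m => #|A| <= m)) => [|A a C c Aa Cc|t _].
  - by rewrite cards0.
  - by apply: leq_trans (leq_card_setU _ _) _; exact: leq_add.
  - exact: ballM.
rewrite -cardsT subset_leq_card //; apply/fintype.subsetP => u _.
apply/negbNE/negP => /finset.bigcupP nBu.
have far t : t \in D -> 2 * d < footrule (f t) (f u).
  move=> tD; rewrite ltnNge; apply/negP => tu.
  by apply: nBu; exists t; rewrite ?inE.
have uD : u \notin D.
  apply/negP => /far; rewrite /footrule big1 // => x _; exact: distnn.
suff /maxD : P (u |: D)%SET by rewrite cardsU1 uD add1n /= ltnn.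
have dfar s t : 2 * d < footrule s t -> d <= @inversion_dist n s t.
  by move=> h; have := leq_trans h (footrule_inversion_dist s t); lia.
apply/forallP => s; apply/implyP => /imsetP[v vD ->].
apply/forallP => t; apply/implyP => /imsetP[w wD ->].
apply/implyP => vw; move: vD wD vw; rewrite !inE.
have [-> _|_ /= vD] := eqVneq v u; have [-> _|_ /= wD] := eqVneq w u.
- by rewrite eqxx.
- by move=> _; apply: dfar; rewrite footruleC; exact: far.
- by move=> _; apply: dfar; exact: far.
- move/forallP/(_ (f v)): PD; rewrite imset_f //= => /forallP/(_ (f w)).
  by rewrite imset_f //= => /implyP.
Qed.

(** * Permutations of bounded displacement *)

Definition band m n : {set 'S_n} :=
  [set u : 'S_n | [forall x, `|u x - x| < m]]%SET.

Lemma card_band_small m n : n <= m -> #|band m n| = n`!.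
Proof.
move=> nm; rewrite -(card_Sn n) cardsE /=; apply: eq_card => u; rewrite !inE.
by apply/forallP => x; have := ltn_ord x; have := ltn_ord (u x); lia.
Qed.

(** Direct sums: [u] acts on the first [a] points and [v] on the last [b], which keeps all
    displacements. *)
Lemma card_band_add m a b : #|band m a| * #|band m b| <= #|band m (a + b)|.
Proof.
pose h (u : 'S_a) (v : 'S_b) (x : 'I_(a + b)) : 'I_(a + b) :=
  unsplit (match fintype.split x with inl i => inl (u i) | inr j => inr (v j) end).
have h_inj u v : injective (h u v).
  move=> x y /(can_inj (@unsplitK _ _)).
  case: (splitP x) => i xi; case: (splitP y) => j yj // [/perm_inj ij];
    by apply: ord_inj; rewrite xi yj ij.
pose g (p : 'S_a * 'S_b) := perm (@h_inj p.1 p.2).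
have g_inj : injective g.
  move=> [u v] [u' v'] /permP guv; congr (_, _); apply/permP => x.
    have := guv (lshift b x); rewrite !permE /h (unsplitK (inl x)) /=.
    by move/lshift_inj.
  have := guv (rshift a x); rewrite !permE /h (unsplitK (inr x)) /=.
  by move/rshift_inj.
rewrite -cardsX -(card_imset _ g_inj); apply: subset_leq_card.
apply/fintype.subsetP => _ /imsetP[[u v] + ->]; rewrite !inE /=.
case/andP=> /forallP uP /forallP vP; apply/forallP => x; rewrite permE /h /=.
case: (splitP x) => i xi /=; rewrite xi; first exact: uP.
by have := vP i; lia.
Qed.

(** * Permutations built from pairs of positions *)

Section Weave.

Variables (n : nat) (r t : 'S_(n./2)).

(* Pair [p] of positions holds the values [2 (r p)] and [2 (t p) + 1]; for odd
   [n] the last position is fixed. *)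
Definition weave_val (x : 'I_n) : nat :=
  if insub x./2 is Some p then if odd x then (t p).*2.+1 else (r p).*2 else x.

Lemma weave_val_subproof x : weave_val x < n.
Proof.
rewrite /weave_val; case: insubP => // p _ _.
by have := ltn_ord (t p); have := ltn_ord (r p); case: odd; lia.
Qed.

(** Parity of the value tells the two positions of a pair apart; an unpaired last position keeps
    [n - 1], above all paired values. *)
Lemma weave_subproof : injective (fun x => Ordinal (weave_val_subproof x)).
Proof.
move=> x y /(congr1 val) /=; rewrite /weave_val => exy; apply: ord_inj.
move: exy; case: insubP => [p _ px|px]; case: insubP => [q _ qy|qy].
- have xE := odd_double_half x; have yE := odd_double_half y.
  case ox : (odd x); case oy : (odd y) => exy; try lia.
    have /ord_inj/perm_inj pq : t p = t q :> nat by lia.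
    by move: xE yE; rewrite -px -qy ox oy pq; lia.
  have /ord_inj/perm_inj pq : r p = r q :> nat by lia.
  by move: xE yE; rewrite -px -qy ox oy pq; lia.
- by have := ltn_ord (t p); have := ltn_ord (r p); case: odd; lia.
- by have := ltn_ord (t q); have := ltn_ord (r q); case: odd; lia.
- by [].
Qed.

Definition weave : 'S_n := perm weave_subproof.

Lemma weave_even (x : 'I_n) (p : 'I_(n./2)) :
  x = p.*2 :> nat -> weave x = (r p).*2 :> nat.
Proof.
move=> xp; rewrite permE /= /weave_val xp odd_double doubleK.
by case: insubP => [q _ /ord_inj -> //|]; rewrite ltn_ord.
Qed.

Lemma weave_odd (x : 'I_n) (p : 'I_(n./2)) :
  x = p.*2.+1 :> nat -> weave x = (t p).*2.+1 :> nat.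
Proof.
move=> xp; rewrite permE /= /weave_val xp /= odd_double uphalf_double.
by case: insubP => [q _ /ord_inj -> //|]; rewrite ltn_ord.
Qed.

End Weave.

Definition evenpos n (p : 'I_(n./2)) : 'I_n.
Proof. by apply: (@Ordinal n p.*2); have := ltn_ord p; lia. Defined.

Definition oddpos n (p : 'I_(n./2)) : 'I_n.
Proof. by apply: (@Ordinal n p.*2.+1); have := ltn_ord p; lia. Defined.

Lemma weave_inj n (r t r' t' : 'S_(n./2)) :
  weave r t = weave r' t' -> r = r' /\ t = t'.
Proof.
move=> e; split; apply/permP => p; apply: ord_inj.
  have := @weave_even _ r t (evenpos p) p erefl.
  by rewrite e (@weave_even _ _ _ _ p) //; lia.
have := @weave_odd _ r t (oddpos p) p erefl.
by rewrite e (@weave_odd _ _ _ _ p) //; lia.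
Qed.

(** The even positions alone contribute twice the left-hand side. Hence balls among the [weave r r]
    are no larger than balls in ['S_(n./2)]. *)
Lemma footrule_weave n (r t r' t' : 'S_(n./2)) :
  footrule r r' <= footrule (weave r t) (weave r' t').
Proof.
have inj_e : injective (@evenpos n).
  by move=> p q /(congr1 val) /= pq; apply: ord_inj; lia.
rewrite /footrule [leqRHS](bigID (mem (@evenpos n @: finset.setT)%SET)) /=.
apply: leq_trans (leq_addr _ _); rewrite big_imset /=; last exact: in2W.
rewrite [leqRHS](eq_bigl predT) => [|p]; last by rewrite inE.
apply: leq_sum => p _.
by rewrite !(@weave_even _ _ _ _ p) //; lia.
Qed.

(** The middle position [i] shares its pair with [h] or [j], and the pair holds [2a] and [2b + 1]
    with [|a - b| < m], at most [2m - 1 <= k] apart. *)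
Lemma weave_constrained n k m (r u : 'S_(n./2)) :
  m.*2 <= k.+1 -> u \in band m n./2 ->
  weave r (r * u)%g \in constrained_perms n k.
Proof.
move=> mk; rewrite inE => /forallP uP; rewrite inE.
apply/forallP => h; apply/forallP => i; apply/forallP => j.
apply/implyP => /andP[/eqP ih /eqP ji].
have lt_p : i./2 < n./2 by have := ltn_ord j; lia.
pose p := Ordinal lt_p; have := uP (r p).
have iE := odd_double_half i; case oi : (odd i) in iE => rp; apply/orP.
  left; rewrite (@weave_odd _ _ _ i p) /=; last by lia.
  rewrite (@weave_even _ _ _ h p) /=; last by lia.
  by rewrite permM; lia.
right; rewrite (@weave_even _ _ _ i p) /=; last by lia.
rewrite (@weave_odd _ _ _ j p) /=; last by lia.
by rewrite permM; lia.
Qed.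

Lemma fact_le_max_code_size n k d : 0 < k ->
  (n./2)`! <= max_code_size n k d * (2 ^ n./2 * 'C(n./2 + 2 * d, n./2)).
Proof.
move=> k_gt0; rewrite -(card_Sn n./2).
(* Writing [r * 1] makes this the case [u = 1], [m = 1] of [weave_constrained]. *)
apply: (@packing_bound _ _ _ _ (fun r => weave r (r * 1)%g)) => [r s|r|r].
- by case/weave_inj.
- apply: (@weave_constrained _ _ 1); first by lia.
  by rewrite inE; apply/forallP => x; rewrite perm1 distnn.
- apply: leq_trans (card_footrule_ball _ r); apply: subset_leq_card.
  apply/fintype.subsetP => s; rewrite !inE; apply: leq_trans.
  exact: footrule_weave.
Qed.

Lemma band_le_max_code_size n k d m : m.*2 <= k.+1 ->
  (n./2)`! * #|band m n./2| <= max_code_size n k d * (2 ^ n * 'C(n + 2 * d, n)).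
Proof.
move=> mk; rewrite -(card_Sn n./2).
rewrite -(card_sig (fun u => u \in band m n./2)) -card_prod.
pose f (p : 'S_(n./2) * {u | u \in band m n./2}) := weave p.1 (p.1 * val p.2)%g.
have f_inj : injective f.
  by move=> [r u] [s v] /weave_inj[/= <- /mulgI/val_inj <-].
apply: (@packing_bound _ _ _ _ f) => // [[r u]|p].
  exact: weave_constrained mk (valP u).
apply: leq_trans (card_footrule_ball _ (f p)); rewrite -(card_imset _ f_inj).
apply: subset_leq_card; apply/fintype.subsetP => _ /imsetP[q + ->].
by rewrite !inE.
Qed.

(** * Quantization bound *)

Section Quantization.

Variables n k m : nat.
Let L := m.+1.

(** [ord_pred] sends 0 to the last position, hence the guard [0 < i]. *)
Definition links (s : 'S_n) : {set 'I_n} :=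
  [set i : 'I_n | (0 < i) && (`|s i - s (ord_pred i)| <= k)]%SET.

(** Largest digit at [i]: quantized entries across a link differ by at most [k %/ L + 1] either
    way. *)
Definition link_base (F : {set 'I_n}) (i : 'I_n) : nat :=
  if i \in F then 2 * (k %/ L).+1 else n %/ L.

(* The code is decoded from left to right: linked positions store the shifted
   increment of the quantized entry, the others the quantized entry itself. *)
Definition link_code F (s : 'S_n) : {dffun forall i, 'I_(link_base F i).+1} :=
  [ffun i => inord (if i \in F
    then s i %/ L + (k %/ L).+1 - s (ord_pred i) %/ L else s i %/ L)].

Lemma val_ord_pred (i : 'I_n) : 0 < i -> ord_pred i = i.-1 :> nat.
Proof.
move=> i_gt0 /=; rewrite -[in (_ + _).-1](prednK i_gt0) addSn /= modnDr.
by rewrite modn_small //; have := ltn_ord i; lia.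
Qed.

(** Adding [b - a] to [a] adds the quotients, with a carry of at most one. *)
Lemma divn_dist (a b : nat) : `|a - b| <= k -> `|a %/ L - b %/ L| <= (k %/ L).+1.
Proof.
wlog ab : a b / a <= b.
  move=> W; case/orP: (leq_total a b) => [/W //|/W].
  by rewrite distnC [`|b %/ L - _|]distnC.
move=> abk; have dk : (b - a) %/ L <= k %/ L by apply: leq_div2r; lia.
have := leq_div2r L ab; have := @divnD a (b - a) L isT.
by rewrite subnKC //; case: (_ <= _); lia.
Qed.

Lemma link_code_inj F (s t : 'S_n) : links s = F -> links t = F ->
  link_code F s = link_code F t -> forall x, s x %/ L = t x %/ L.
Proof.
move=> sF tF /ffunP st x; have [j] := ubnP (x : nat).
elim: j x => // j IHj x xj.
have := congr1 val (st x); rewrite !ffunE /=.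
have lt_n (v : 'S_n) : v x %/ L <= n %/ L by rewrite leq_div2r // ltnW.
case: ifPn => xF; last first.
  by rewrite !inordK ?ltnS /link_base ?(negPf xF) ?lt_n.
have [x_gt0 sx] : 0 < x /\ `|s x - s (ord_pred x)| <= k.
  by apply/andP; move: xF; rewrite -sF inE.
have tx : `|t x - t (ord_pred x)| <= k.
  by move: xF; rewrite -tF inE => /andP[].
have {}sx := divn_dist sx; have {}tx := divn_dist tx.
have /IHj eq_pred : ord_pred x < j by rewrite val_ord_pred // prednK.
move: sx tx; rewrite /link_base xF -eq_pred.
move: (s x %/ L) (t x %/ L) (s (ord_pred x) %/ L) (k %/ L).+1 => a b c D {st lt_n}.
(* Neither the truncated subtraction nor [inord] loses anything, as [a] and [b] are within [D] of
   the common predecessor [c]. *)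
by move=> aD bD; rewrite !inordK; lia.
Qed.

(** [uphalf] groups the positions as 0; 1, 2; 3, 4; and so on. Two unlinked positions in one group
    would violate the constraint at the first of them. *)
Lemma card_links (s : 'S_n) : two_neighbor k s -> #|~: links s| <= n./2.+1.
Proof.
move=> sk; rewrite -[n./2.+1]card_ord.
have half_lt (i : 'I_n) : uphalf i < n./2.+1 by have := ltn_ord i; lia.
rewrite -(@card_in_imset _ _ (fun i => Ordinal (half_lt i))) ?max_card //.
have no2 (i j : 'I_n) : j = i.+1 :> nat -> odd i ->
    i \notin links s -> j \notin links s -> False.
  move=> ji oi iF jF.
  move/forallP/(_ (ord_pred i))/forallP/(_ i)/forallP/(_ j)/implyP : sk.
  have i_gt0 : 0 < i by case: (nat_of_ord i) oi.
  rewrite val_ord_pred // ji prednK // !eqxx /= => /(_ isT).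
  have ei : ord_pred j = i by apply: ord_inj; rewrite val_ord_pred; lia.
  move: iF jF; rewrite !inE i_gt0 ei ji /= => /negPf iF /negPf jF.
  by rewrite distnC iF distnC jF.
move=> i j; rewrite !inE => iF jF /(congr1 val) /= ij.
have [lt_ij|lt_ji|/ord_inj //] := ltngtP i j.
  by case: (@no2 i j); rewrite ?inE //; lia.
by case: (@no2 j i); rewrite ?inE //; lia.
Qed.

(** With [y] for [(k %/ L).+1], a linked position has [2 * y + 1 <= 3 * y] choices. Since [y <= x],
    the worst case has as many unlinked positions as allowed. *)
Lemma leq_prod_link_base F : k <= n -> #|~: F| <= n./2.+1 ->
  \prod_i (link_base F i).+1 <=
  3 ^ n * ((n %/ L).+1 ^ n./2.+1 * (k %/ L).+1 ^ n./2).
Proof.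
move=> kn cF; set x := (n %/ L).+1; set y := (k %/ L).+1.
have yx : y <= x by rewrite ltnS leq_div2r.
apply: (@leq_trans (\prod_(i < n) (3 * (if i \in F then y else x)))).
  by apply: leq_prod => i _; rewrite /link_base; case: ifP; lia.
rewrite big_split /= prod_nat_const card_ord leq_mul2l; apply/orP; right.
rewrite (bigID (mem F)) /= (eq_bigr (fun=> y)); last by move=> i ->.
rewrite [X in _ * X](eq_bigr (fun=> x)); last by move=> i /negPf ->.
rewrite !prod_nat_const.
have := cardsC F; rewrite card_ord.
have -> : #|[pred i | i \notin F]| = #|~: F| by apply: eq_card => i; rewrite !inE.
move: #|~: F| #|F| cF => b f cb Fb.
have -> : n./2.+1 = b + (n./2.+1 - b) by lia.
rewrite expnD mulnC -mulnA leq_mul2l; apply/orP; right.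
have yx_exp e : y ^ e <= x ^ e by case: e => // e; rewrite leq_exp2r.
apply: leq_trans (leq_mul (yx_exp _) (leqnn _)).
by rewrite -expnD; apply: leq_pexp2l => //; clear -cb Fb; lia.
Qed.

(** The code is split by link set, at most [2 ^ n] classes. On each class [link_code] is injective,
    since codewords with equal quantization are at distance at most [2 * m * n < d]. *)
Lemma max_code_size_le d : k <= n -> 2 * m * n < d ->
  max_code_size n k d <=
  6 ^ n * ((n %/ L).+1 ^ n./2.+1 * (k %/ L).+1 ^ n./2).
Proof.
move=> kn md; apply/bigmax_leqP => C /andP[/fintype.subsetP CA Cd].
have C_inj (s t : 'S_n) : s \in C -> t \in C ->
    (forall x, s x %/ L = t x %/ L) -> s = t.
  move=> sC tC st; apply/eqP/negbNE/negP => ne_st.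
  move/forallP/(_ s)/implyP/(_ sC)/forallP/(_ t)/implyP/(_ tC)/implyP/(_ ne_st): Cd.
  by have := inversion_dist_block st; lia.
rewrite -sum1_card (partition_big links predT) //=.
have -> : 6 ^ n = 2 ^ n * 3 ^ n by rewrite -expnMn.
have -> : 2 ^ n = #|{: {set 'I_n}}|.
  by rewrite -cardsT -powersetT card_powerset cardsT card_ord.
rewrite -mulnA -sum_nat_const; apply: leq_sum => F _.
have [s0 /andP[s0C /eqP s0F]|none] := pickP [pred s in C | links s == F]; last first.
  by rewrite big_pred0.
rewrite sum1_card.
have cF : #|~: F| <= n./2.+1.
  by rewrite -s0F card_links //; have := CA _ s0C; rewrite inE.
apply: leq_trans (leq_prod_link_base kn cF).
have link_inj : {in [pred s in C | links s == F] &, injective (link_code F)}.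
  move=> s t; rewrite !inE => /andP[sC /eqP sF] /andP[tC /eqP tF] st.
  by apply: C_inj => //; exact: link_code_inj st.
rewrite -(card_in_imset link_inj); apply: leq_trans (max_card _) _.
rewrite card_dep_ffun foldrE big_map big_enum /=.
by apply: leq_prod => i _; rewrite card_ord.
Qed.

End Quantization.

Local Open Scope ring_scope.

(** * Asymptotics *)

Section Estimates.

Variable R : realType.
Implicit Types (x y : R) (n m d k D : nat).

Lemma ler_ln_pos x y : 0 < x -> x <= y -> ln x <= ln y.
Proof. by move=> x0 xy; rewrite ler_ln ?posrE // (lt_le_trans x0). Qed.

Lemma natr_pos n : (0 < n)%N -> 0 < n%:R :> R.
Proof. by rewrite ltr0n. Qed.

Lemma ln_natM (a b : nat) : (0 < a)%N -> (0 < b)%N ->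
  ln (a * b)%:R = ln a%:R + ln b%:R :> R.
Proof. by move=> a0 b0; rewrite natrM lnM // posrE ltr0n. Qed.

Lemma ln_natX (a e : nat) : (0 < a)%N -> ln (a ^ e)%:R = e%:R * ln a%:R :> R.
Proof. by move=> a0; rewrite natrX lnXn ?ltr0n // mulr_natl. Qed.

Lemma ler_ln_nat (a b : nat) : (0 < a)%N -> (a <= b)%N ->
  ln a%:R <= ln b%:R :> R.
Proof. by move=> a0 ab; apply: ler_ln_pos; rewrite ?ltr0n ?ler_nat. Qed.

Lemma ln_nat_ge0 n : 0 <= ln n%:R :> R.
Proof. by case: n => [|n]; [rewrite ln0 | rewrite ln_ge0 // ler1n]. Qed.

Lemma ln_nat_le n : ln n%:R <= n%:R :> R.
Proof. by case: n => [|n]; [rewrite ln0 | rewrite ltW // ln_sublinear // ltr0n]. Qed.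

(* [ln (y / x) <= y / x - 1], multiplied by [x]. *)
Lemma mulr_ln_ratio x y : 0 < x -> 0 < y -> x * (ln y - ln x) <= y - x.
Proof.
move=> x0 y0; rewrite -ln_div ?posrE //.
have : ln (1 + (y / x - 1)) <= y / x - 1.
  by apply: le_ln1Dx; rewrite ltrBrDl subrr divr_gt0.
have -> : y - x = x * (y / x - 1) by field; rewrite gt_eqF.
by rewrite addrC subrK ler_pM2l.
Qed.

(** Weak Stirling bound; the induction step amounts to [n * (ln (n + 1) - ln n) <= 1]. *)
Lemma ln_fact_ge n : n%:R * ln n%:R - n%:R <= ln n`!%:R :> R.
Proof.
elim: n => [|n IHn]; first by rewrite mul0r subr0 fact0 ln1.
rewrite factS ln_natM ?fact_gt0 //.
have [->|n_gt0] := posnP n; first by rewrite fact0 ln1; lra.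
have := mulr_ln_ratio (natr_pos n_gt0) (natr_pos (ltn0Sn n)).
by rewrite -natr1; move: (ln _) (ln _) (ln _) IHn => a b c; nra.
Qed.

Lemma ln_fact_le n : ln n`!%:R <= n%:R * ln n%:R :> R.
Proof.
elim: n => [|n IHn]; first by rewrite mul0r fact0 ln1.
rewrite factS ln_natM ?fact_gt0 // -natr1 [leRHS]mulrDl mul1r [leLHS]addrC lerD2r natr1.
rewrite (le_trans IHn) // ler_wpM2l //.
by case: n {IHn} => [|n]; [rewrite ln0 // ln1 | apply: ler_ln_nat].
Qed.

Lemma ffact_le_exp n m : (n ^_ m <= n ^ m)%N.
Proof.
elim: m => [|m IHm]; first by rewrite ffactn0.
by rewrite ffactnSr expnSr leq_mul // leq_subr.
Qed.

(** [n!] times the binomial is a falling factorial, at most [(n + D) ^ n]. *)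
Lemma ln_bin_le n D :
  ln 'C(n + D, n)%:R <= n%:R * ln (n + D)%:R - ln n`!%:R :> R.
Proof.
have [->|n_gt0] := posnP n; first by rewrite bin0 fact0 ln1 mul0r subrr.
rewrite lerBrDr -ln_natM ?fact_gt0 ?bin_gt0 ?leq_addr // bin_ffact -ln_natX.
  by apply: ler_ln_nat (ffact_le_exp _ _); rewrite ffact_gt0 leq_addr.
by rewrite addn_gt0 n_gt0.
Qed.

Lemma card_band_gt0 m n : (0 < m)%N -> (0 < #|band m n|)%N.
Proof.
move=> m_gt0; apply/card_gt0P; exists 1%g; rewrite inE; apply/forallP => x.
by rewrite perm1 distnn.
Qed.

(** Blocks of length [m] are permuted independently, each giving [m!]; the term [- m] pays for the
    last, possibly shorter block. *)
Lemma ln_card_band_ge m n : (0 < m)%N ->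
  n%:R * ln m%:R - n%:R - m%:R <= ln #|band m n|%:R :> R.
Proof.
move=> m_gt0; have [p] := ubnP n; elim: p n => // p IHp n np.
have [nm|mn] := leqP n m.
  rewrite card_band_small //; apply: le_trans (ln_fact_ge n).
  have [->|n_gt0] := posnP n; first by rewrite !mul0r; have := ler0n R m; lra.
  have := mulr_ln_ratio (natr_pos n_gt0) (natr_pos m_gt0).
  have := ler0n R n; lra.
have -> : n = (m + (n - m))%N by rewrite subnKC // ltnW.
have /IHp : (n - m < p)%N by lia.
move: (n - m)%N => q IHq.
apply: le_trans (ler_ln_nat _ (card_band_add m m q)); last first.
  by rewrite muln_gt0 !card_band_gt0.
rewrite ln_natM ?card_band_gt0 // card_band_small // natrD.
have := ln_fact_ge m; move: IHq; lra.
Qed.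

End Estimates.

(** * Bounds at a fixed length *)

Section Rate.

Variables (R : realType) (e1 e2 : R).
Hypotheses (he1 : 0 <= e1 <= 1) (he2 : 0 <= e2 <= 2).

Lemma ceil_pow_ge n e : n%:R `^ e <= (ceil_pow n e)%:R :> R.
Proof.
rewrite natr_absz ger0_norm ?ceil_ge // ceil_ge0.
by apply: lt_le_trans (powR_ge0 _ _); rewrite oppr_lt0.
Qed.

Lemma ceil_pow_lt n e : (ceil_pow n e)%:R < n%:R `^ e + 1 :> R.
Proof.
rewrite natr_absz ger0_norm; last first.
  by rewrite ceil_ge0 (lt_le_trans _ (powR_ge0 _ _)) ?oppr_lt0.
by have /andP[+ _] := ceil_itv (n%:R `^ e : R); rewrite intrB ltrBlDr.
Qed.

Lemma ceil_pow_gt0 n (e : R) : (0 < n)%N -> (0 < ceil_pow n e)%N.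
Proof.
move=> n_gt0; rewrite -(ltr0n R); apply: lt_le_trans (ceil_pow_ge _ _).
by rewrite powR_gt0 // ltr0n.
Qed.

Lemma ceil_pow_le n (e : R) : (0 < n)%N -> e <= 1 -> (ceil_pow n e <= n)%N.
Proof.
move=> n_gt0 e_le1; rewrite -ltnS -(ltr_nat R) -natr1.
apply: lt_le_trans (ceil_pow_lt _ _) _.
by rewrite lerD2r ler1_powR // ler1n.
Qed.

(** [n ^ w] is the order of [n + d], so the block length [L] has order [n ^ (w - 1)] and [k / L + 1]
    has order [n ^ b]. *)
Let w : R := Num.max 1 e2.
Let b : R := Num.max 0 (1 + e1 - w).

(** Half of the entries have exponent [2 - w], that of [n / L], and half have exponent [b]. *)
Definition growth : R := (2 - w + b) / 2.

Variable n : nat.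
Hypothesis n_gt1 : (1 < n)%N.

Let n_gt0 : (0 < n)%N := ltnW n_gt1.
Let k := ceil_pow n e1.
Let d := ceil_pow n e2.
Let E := max_code_size n k d.
Let p (x : R) := n%:R `^ x.
Let l : R := ln n%:R.

Let pD x y : p (x + y) = p x * p y.
Proof. by rewrite /p powRD // pnatr_eq0 -lt0n n_gt0 implybT. Qed.

Let p_gt0 x : 0 < p x.
Proof. by rewrite powR_gt0 // ltr0n. Qed.

Let le_p x y : x <= y -> p x <= p y.
Proof. by apply: ler_powR; rewrite ler1n. Qed.

Let p_ge1 x : 0 <= x -> 1 <= p x.
Proof. by move/le_p; rewrite [p 0]powRr0. Qed.

Let p1 : p 1 = n%:R.
Proof. by rewrite /p powRr1 // ler0n. Qed.

Let ln_p c x : 0 < c -> ln (c * p x) <= c + x * l.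
Proof.
move=> c0; rewrite lnM ?posrE // ln_powR lerD2r.
by rewrite ltW // ln_sublinear.
Qed.

Let w_ge1 : 1 <= w. Proof. by rewrite le_max lexx. Qed.
Let w_ge2 : e2 <= w. Proof. by rewrite le_max lexx orbT. Qed.
Let w_le2 : w <= 2.
Proof. by case/andP: he2 => _ h; rewrite ge_max h andbT ler1n. Qed.
Let b_ge0 : 0 <= b. Proof. by rewrite le_max lexx. Qed.
Let b_ge1 : 1 + e1 - w <= b. Proof. by rewrite le_max lexx orbT. Qed.
Let l_ge0 : 0 <= l. Proof. exact: ln_nat_ge0. Qed.
Let l_le : l <= n%:R. Proof. exact: ln_nat_le. Qed.
Let n_ge1 : 1 <= n%:R :> R. Proof. by rewrite ler1n. Qed.

Let half_le : n./2%:R <= n%:R / 2 :> R.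
Proof.
rewrite ler_pdivlMr // -natrM ler_nat muln2.
by rewrite -[leqRHS]odd_double_half leq_addl.
Qed.

(* Largest value with [2 * m * n < d]; blocks have length [m.+1]. *)
Let m := (d.-1 %/ (2 * n))%N.

(** If [e2 <= 1] the left side is 1; otherwise [n ^ e2 <= d <= 2 * n * m.+1]. *)
Let p_le_block : p (w - 1) <= 2 * m.+1%:R.
Proof.
have [e2_le1|e2_gt1] := leP e2 1.
  rewrite /w max_l // subrr /p powRr0 -natr1.
  by have := ler0n R m; lra.
have -> : w = e2 by rewrite /w max_r // ltW.
rewrite -(ler_pM2r (_ : 0 < n%:R)) ?ltr0n //.
have -> : p (e2 - 1) * n%:R = p e2 by rewrite -p1 -pD subrK.
apply: le_trans (ceil_pow_ge _ _) _; rewrite -!natrM ler_nat -/d.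
have d_gt0 : (0 < d)%N by exact: ceil_pow_gt0.
by rewrite -[leqLHS](prednK d_gt0) mulnAC mulnC ltn_ceil // muln_gt0.
Qed.

Let quotient_le (a : nat) c : a%:R <= c * p (w - 1) ->
  (a %/ m.+1)%:R <= 2 * c.
Proof.
move=> ac; rewrite -(ler_pM2r (p_gt0 (w - 1))).
have : (a %/ m.+1 * m.+1)%:R <= a%:R :> R by rewrite ler_nat leq_trunc_div.
rewrite natrM; have := ler0n R (a %/ m.+1).
move: p_le_block ac; move: (p _) => q; nra.
Qed.

Lemma ln_code_le : ln E%:R <= growth * (n%:R * l) + 20 * n%:R.
Proof.
have kn : (k <= n)%N by apply: ceil_pow_le; case/andP: he1.
have md : (2 * m * n < d)%N.
  have d_gt0 : (0 < d)%N by exact: ceil_pow_gt0.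
  by rewrite -mulnAC mulnC -[ltnRHS](prednK d_gt0) ltnS leq_trunc_div.
have := max_code_size_le kn md; rewrite -/E.
set X := (n %/ m.+1).+1; set Y := (k %/ m.+1).+1 => leE.
have lnX : ln X%:R <= 3 + (2 - w) * l.
  apply: le_trans (ln_p _ _) => //; apply: ler_ln_pos; first by rewrite ltr0n.
  rewrite /X -natr1; have : (n %/ m.+1)%:R <= 2 * p (2 - w).
    apply: quotient_le; rewrite -pD.
    have -> : 2 - w + (w - 1) = 1 by ring.
    by rewrite p1 lexx.
  have := @p_ge1 (2 - w); rewrite subr_ge0 => /(_ w_le2); lra.
(* [k <= 2 * n ^ e1] gives a quotient of at most [4 * n ^ b], and the successor adds at most
   [n ^ b]. *)
have lnY : ln Y%:R <= 5 + b * l.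
  apply: le_trans (ln_p _ _) => //; apply: ler_ln_pos; first by rewrite ltr0n.
  rewrite /Y -natr1; have : (k %/ m.+1)%:R <= 2 * (2 * p (1 + e1 - w)).
    apply: quotient_le; rewrite -mulrA -pD.
    have -> : 1 + e1 - w + (w - 1) = e1 by ring.
    have := ceil_pow_lt n e1; have := @p_ge1 e1; rewrite -/k.
    by case/andP: he1 => -> _ /(_ isT); rewrite -/(p e1); lra.
  have := p_ge1 b_ge0; have := le_p b_ge1; lra.
(* [ln] is 0 at 0, so this case only needs a nonnegative bound. *)
have [->|E_gt0] := posnP E.
  rewrite ln0 // addr_ge0 ?mulr_ge0 // /growth.
  by move: w_le2 b_ge0; lra.
apply: le_trans (ler_ln_nat _ E_gt0 leE) _.
rewrite !ln_natM ?muln_gt0 ?expn_gt0 // !ln_natX // /growth.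
have ln6 : ln 6 <= 6 :> R := ln_nat_le R 6.
have := half_le; have : 0 <= n./2%:R :> R by [].
have : 0 <= ln X%:R :> R by exact: ln_nat_ge0.
have : 0 <= ln Y%:R :> R by exact: ln_nat_ge0.
rewrite -[n./2.+1%:R]natr1.
move: (ln 6) (ln X%:R) (ln Y%:R) ln6 lnX lnY (n./2%:R).
move=> A B C lnA lnB lnC N C0 B0 N0 Nn.
have h1 : (N + 1) * B <= (n%:R / 2 + 1) * (3 + (2 - w) * l).
  by apply: ler_pM; lra.
have h2 : N * C <= (n%:R / 2) * (5 + b * l) by apply: ler_pM; lra.
have h3 : n%:R * A <= n%:R * 6 by rewrite ler_wpM2l.
(* This absorbs the extra factor [X] of the exponent [n./2.+1]. *)
have h4 : (2 - w) * l <= 1 * n%:R.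
  by apply: ler_pM; move: w_ge1 w_le2 l_ge0 l_le; lra.
have -> : (2 - w + b) / 2 * (n%:R * l) =
    n%:R / 2 * ((2 - w) * l) + n%:R / 2 * (b * l) by ring.
rewrite mulrDl mul1r in h1; rewrite !mulrDr in h1 h2.
move: n_ge1; lra.
Qed.

Let half_ge : n%:R / 2 - 1 / 2 <= n./2%:R :> R.
Proof.
have : (n <= 1 + n./2 * 2)%N by clear; lia.
by rewrite -(ler_nat R) natrD natrM; lra.
Qed.

Let ln_half_ge : l - 3 <= ln n./2%:R.
Proof.
have n3 : (n <= 3 * n./2)%N by clear -n_gt1; lia.
have := ler_ln_nat R n_gt0 n3; rewrite ln_natM //; last by clear -n_gt1; lia.
by have := ln_nat_le R 3; rewrite -/l; lra.
Qed.

(** The sum is at most [n + 2 * (n ^ e2 + 1) <= 5 * n ^ w]. *)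
Let ln_radius_le q : (0 < q <= n)%N -> ln (q + 2 * d)%:R <= 5 + w * l.
Proof.
case/andP=> q_gt0 qn; apply: le_trans (ln_p _ _) => //.
apply: ler_ln_pos; first by rewrite ltr0n addn_gt0 q_gt0.
rewrite natrD natrM; have : q%:R <= n%:R :> R by rewrite ler_nat.
have := ceil_pow_lt n e2; rewrite -/d -/(p e2).
have := le_p w_ge2; have := le_p w_ge1; rewrite p1.
by have := @p_ge1 w; move: w_ge1; lra.
Qed.

Let k_gt0 : (0 < k)%N. Proof. exact: ceil_pow_gt0. Qed.

Let E_gt0 : (0 < E)%N.
Proof.
have := fact_le_max_code_size n d k_gt0.
rewrite -/E; have [->|//] := posnP E.
by rewrite mul0n leqNgt fact_gt0.
Qed.

(** With [h = n./2], [ln E] is at least [2 ln h! - h ln (h + 2d)] up to [O(n)], of leading order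
    [n l - (n / 2) w l]. *)
Let ln_code_ge_half : (2 - w) / 2 * (n%:R * l) - 20 * n%:R <= ln E%:R.
Proof.
have half_gt0 : (0 < n./2)%N by clear -n_gt1; lia.
have := ler_ln_nat R (fact_gt0 _) (fact_le_max_code_size n d k_gt0).
have bin_n : (0 < 'C(n./2 + 2 * d, n./2))%N by rewrite bin_gt0 leq_addr.
rewrite !ln_natM ?muln_gt0 ?expn_gt0 // ln_natX //.
have := ln_bin_le R n./2 (2 * d); have := ln_fact_ge R n./2.
have /ln_radius_le : (0 < n./2 <= n)%N by clear -n_gt1; lia.
move: ln_half_ge half_le half_ge (ln_nat_le R 2) (ler0n R n./2).
rewrite -/E; move: (ln E%:R) (ln 2) (ln n./2%:R) (ln (n./2)`!%:R) => e t h f.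
move: (ln (n./2 + 2 * d)%:R) (ln 'C(n./2 + 2 * d, n./2)%:R) => r c.
move: (n./2%:R) => N lh Nle Nge t2 N0 rle fge cle fle.
have h1 : N * r <= N * (5 + w * l) by rewrite ler_wpM2l.
have h2 : N * (l - 3) <= N * h by rewrite ler_wpM2l.
have h3 : N * t <= N * 2 by rewrite ler_wpM2l.
have h4 : (2 - w) * l <= 1 * n%:R.
  by apply: ler_pM; move: w_ge1 w_le2 l_ge0 l_le; lra.
have h5 : (n%:R / 2 - 1 / 2) * ((2 - w) * l) <= N * ((2 - w) * l).
  by rewrite ler_wpM2r // mulr_ge0 //; move: w_le2; lra.
move: h1 h2 h3 h4 h5; rewrite !(mulrDr, mulrDl); lra.
Qed.

(** The family contributes [(1 + e1) / 2] and the ball in ['S_n] costs [w - 1], in units of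
    [n * l]. *)
Let ln_code_ge_band :
  (3 + e1 - 2 * w) / 2 * (n%:R * l) - 20 * n%:R <= ln E%:R.
Proof.
(* The maximum with 1 covers [k = 1]. Then [2 * q <= k + 1] as the weave requires, while
   [k <= 3 * q] loses only a constant in [ln q]. *)
pose q := maxn 1 k./2.
have q_gt0 : (0 < q)%N by rewrite leq_max.
have qk : (q.*2 <= k.+1)%N by rewrite /q; move: k k_gt0; clear; lia.
have qn : (q <= n)%N.
  have : (k <= n)%N by apply: ceil_pow_le; case/andP: he1.
  by rewrite /q; move: k n_gt0; clear; lia.
have ln_q : e1 * l - 3 <= ln q%:R.
  have kq : (k <= 3 * q)%N by rewrite /q; move: k k_gt0; clear; lia.
  have := ler_ln_nat R k_gt0 kq; rewrite ln_natM //.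
  have := ler_ln_pos (p_gt0 e1) (ceil_pow_ge n e1); rewrite ln_powR -/k.
  by have := ln_nat_le R 3; rewrite -/l; lra.
have := ler_ln_nat R _ (band_le_max_code_size n d qk).
rewrite muln_gt0 fact_gt0 card_band_gt0 // => /(_ isT).
have bin_n : (0 < 'C(n + 2 * d, n))%N by rewrite bin_gt0 leq_addr.
rewrite !ln_natM ?muln_gt0 ?expn_gt0 ?fact_gt0 ?card_band_gt0 // ln_natX //.
have := ln_bin_le R n (2 * d); have := ln_fact_ge R n./2.
have := ln_fact_ge R n; have := ln_card_band_ge R n./2 q_gt0.
have /ln_radius_le : (0 < n <= n)%N by rewrite n_gt0 leqnn.
have : q%:R <= n%:R :> R by rewrite ler_nat.
move: ln_q ln_half_ge half_le half_ge (ln_nat_le R 2) (ler0n R n./2).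
rewrite -/E -/l.
move: (ln E%:R) (ln 2) (ln q%:R) (ln n./2%:R) (ln n`!%:R) => e t lq h fn.
move: (ln (n./2)`!%:R) (ln #|band q n./2|%:R) => f B.
move: (ln 'C(n + 2 * d, n)%:R) (ln (n + 2 * d)%:R) => c r.
move: (n./2%:R) (q%:R) => N Q lqge lh Nle Nge t2 N0 Qn.
move=> rle cge fnge fge Ble le_e.
have h1 : n%:R * r <= n%:R * (5 + w * l) by rewrite ler_wpM2l.
have h2 : N * (l - 3) <= N * h by rewrite ler_wpM2l.
have h3 : n%:R * t <= n%:R * 2 by rewrite ler_wpM2l.
have h6 : N * (e1 * l - 3) <= N * lq by rewrite ler_wpM2l.
have h4 : (1 + e1) * l <= 2 * n%:R.
  by case/andP: he1 => e10 e11; apply: ler_pM; move: l_ge0 l_le; lra.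
have h5 : (n%:R / 2 - 1 / 2) * ((1 + e1) * l) <= N * ((1 + e1) * l).
  by rewrite ler_wpM2r // mulr_ge0 //; case/andP: he1; lra.
move: h1 h2 h3 h4 h5 h6; rewrite !(mulrDr, mulrDl); lra.
Qed.

(** Each construction attains one of the two values of the maximum [b]. *)
Lemma ln_code_ge : growth * (n%:R * l) - 20 * n%:R <= ln E%:R.
Proof.
rewrite /growth /b; have [_|_] := leP 0 (1 + e1 - w); last by rewrite addr0.
by have -> : 2 - w + (1 + e1 - w) = 3 + e1 - 2 * w by ring.
Qed.

End Rate.

(** * Convergence of the rate *)

Lemma growthE (R : realType) (e1 e2 : R) : 0 <= e1 <= 1 -> 0 <= e2 <= 2 ->
  growth e1 e2 =
    if e2 <= 1 then 1 / 2 + e1 / 2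
    else if e2 <= 1 + e1 then 3 / 2 + e1 / 2 - e2
    else 1 - e2 / 2.
Proof.
case/andP=> e1_ge0 e1_le1 /andP[e2_ge0 e2_le2]; rewrite /growth /=.
have [e2_le1|e2_gt1] := leP e2 1; first by rewrite max_r; lra.
by have [e2_le|e2_gt] := leP e2 (1 + e1); [rewrite max_r | rewrite max_l]; lra.
Qed.

Lemma code_rate_cvg (R : realType) (e1 e2 : R) :
  0 <= e1 <= 1 -> 0 <= e2 <= 2 ->
  (code_rate e1 e2 @ \oo --> growth e1 e2)%classic.
Proof.
move=> he1 he2; apply/cvgrPdist_le => eps eps_gt0.
have [g_ge0 g_le1] : 0 <= growth e1 e2 /\ growth e1 e2 <= 1.
  rewrite growthE //; case/andP: he1 => ? ?; case/andP: he2 => ? ?.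
  by have [?|?] := leP e2 1; [|have [?|?] := leP e2 (1 + e1)]; split; lra.
near=> n.
have n_gt1 : (1 < n)%N by near: n; exact: nbhs_infty_gt.
have n_pos : 0 < n%:R :> R by rewrite ltr0n ltnW.
(* Of the 21, 20 come from the bounds on [ln E], and 1 from replacing [n * ln n] by [ln n!], as
   [growth] is at most 1. *)
have ln_big : 1 + 21 / eps < ln n%:R.
  rewrite -[ltLHS]expRK ltr_ln ?posrE ?expR_gt0 //.
  by near: n; exact: nbhs_infty_gtr.
have ln_fact_big : 21 * n%:R <= eps * ln n`!%:R.
  apply: le_trans (_ : eps * (n%:R * ln n%:R - n%:R) <= _); last first.
    by rewrite ler_pM2l // ln_fact_ge.
  have -> : eps * (n%:R * ln n%:R - n%:R) = n%:R * (eps * (ln n%:R - 1)) by ring.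
  rewrite [leLHS]mulrC ler_pM2l // -ler_pdivrMl // mulrC.
  by move: ln_big; lra.
have fact_pos : 0 < ln n`!%:R :> R.
  rewrite -(pmulr_rgt0 _ eps_gt0); apply: lt_le_trans ln_fact_big.
  by rewrite mulr_gt0.
have ln2_neq0 : ln 2 != 0 :> R by rewrite gt_eqF // ln_gt0 // ltr1n.
rewrite /code_rate /log2.
have := ln_code_le he1 he2 n_gt1; have := ln_code_ge he1 he2 n_gt1.
have := ln_fact_ge R n; have := ln_fact_le R n.
move: (max_code_size _ _ _) => E; move: fact_pos ln_fact_big.
move: (ln n`!%:R) (ln E%:R) => F e F_pos eF F_le F_ge e_ge e_le.
have -> : e / ln 2 / (F / ln 2) = e / F by field; rewrite ln2_neq0 gt_eqF.
have -> : growth e1 e2 - e / F = (growth e1 e2 * F - e) / F.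
  by field; rewrite gt_eqF.
rewrite normrM [`|F^-1|]gtr0_norm ?invr_gt0 // ler_pdivrMr //.
apply: le_trans eF; rewrite ler_norml.
have h1 : growth e1 e2 * F <= growth e1 e2 * (n%:R * ln n%:R).
  by rewrite ler_wpM2l.
have h2 : growth e1 e2 * (n%:R * ln n%:R - n%:R) <= growth e1 e2 * F.
  by rewrite ler_wpM2l.
have h3 : growth e1 e2 * n%:R <= n%:R by rewrite ler_piMl // ltW.
move: h1 h2 h3 e_ge e_le; rewrite mulrBr => h1 h2 h3 e_ge e_le.
by apply/andP; split; lra.
Unshelve. all: by end_near. Qed.

Theorem corollary2 (R : realType) (e1 e2 : R)
    (he1 : 0 <= e1 <= 1) (he2 : 0 <= e2 <= 2) :
  cvg (code_rate e1 e2 @ \oo)%classic /\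
  capacity e1 e2 =
    if e2 <= 1 then 1 / 2 + e1 / 2
    else if e2 <= 1 + e1 then 3 / 2 + e1 / 2 - e2
    else 1 - e2 / 2.
Proof.
have rate_cvg := code_rate_cvg he1 he2; split.
  by apply/cvg_ex; exists (growth e1 e2).
by rewrite -growthE //; apply/cvg_lim.
Qed.
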